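(* Let $(X,d)$ be a complete metric space, let $g:X\to\mathbb{R}$ be bounded above, and let $\theta(\cdot,\cdot):X\times X\to\mathbb{R}$ satisfy $\theta(x,y)\ge\theta$ for all $x,y\in X$, for some constant $\theta>0$. For $x\in X$ let $$W(x)=\{y\in X:\ g(y)-g(x)\ge\theta(x,y)\,d(x,y)\},\qquad S(x)=\{y\in X:\ g(y)-g(x)\ge\theta\,d(x,y)\},$$ so that $W(x)\subset S(x)$. Let $x_0\in X$ and let $(x_n)_{n\in\mathbb{N}}$ be a sequence with $x_{n+1}\in W(x_n)$ for all $n\in\mathbb{N}$. Then there exists $x^{\ast}\in X$ such that $x_n\to x^{\ast}$ as $n\to+\infty$.
   Context: Interpretation: $X$ is a state space, $g$ is the per unit of time utility, $W(x)$ is the ''worthwhile-to-move'' set at $x$ and $S(x)$ is the set enclosing it; the lower bound $\theta>0$ on $\theta(x,y)$ expresses ''high enough local costs to move''. The exploitation time is normalized to $1$. *)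

(* Defs.v *)
From HB Require Import structures.
From mathcomp Require Import all_boot all_order all_algebra.
From mathcomp Require Import all_classical all_reals all_analysis.

Set Implicit Arguments.
Unset Strict Implicit.
Unset Printing Implicit Defensive.

Import Order.TTheory GRing.Theory Num.Theory.
Import numFieldNormedType.Exports.

Local Open Scope classical_set_scope.
Local Open Scope ring_scope.

(* The topology and uniformity of a metricType are those of its distance
   mdist (ballEmdist). Complete carries a point, so these spaces are
   nonempty. *)
#[short(type="completeMetricType")]
HB.structure Definition CompleteMetric (R : numDomainType) :=
  {T of Complete T & Metric R T}.

Definition worthwhile (R : realType) (X : metricType R) (g : X -> R)
    (theta : X -> X -> R) (x : X) : set X :=
  [set y | g y - g x >= theta x y * mdist x y].

Definition enclosing (R : realType) (X : metricType R) (g : X -> R)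
    (theta0 : R) (x : X) : set X :=
  [set y | g y - g x >= theta0 * mdist x y].

(* Main.v *)
Require Import Defs.
From HB Require Import structures.
From mathcomp Require Import all_boot all_order all_algebra.
From mathcomp Require Import all_classical all_reals all_analysis.

Set Implicit Arguments.
Unset Strict Implicit.
Unset Printing Implicit Defensive.

Import Order.TTheory GRing.Theory Num.Theory.
Import numFieldNormedType.Exports.

Local Open Scope classical_set_scope.
Local Open Scope ring_scope.

(** A worthwhile move costs at least [theta0] units of utility per unit of
    distance, so utility telescopes along the path: between times [m <= n] the
    displacement is at most [(g (x_ n) - g (x_ m)) / theta0], which is
    [enclosing_path].  As utility is bounded above, at some time it comes within [theta0 * e] of its supremum
    along the path; the utility that remains to be gained pays for no later
    displacement of length [e].  The sequence is therefore Cauchy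
    ([enclosing_path_cauchy]), and completeness gives the limit. *)

Lemma worthwhile_sub_enclosing (R : realType) (X : metricType R) (g : X -> R)
    (theta : X -> X -> R) (theta0 : R) (x : X) :
  (forall x y, theta0 <= theta x y) ->
  worthwhile g theta x `<=` enclosing g theta0 x.
Proof.
move=> theta_ge y; rewrite /worthwhile /enclosing /=.
by apply: le_trans; rewrite ler_wpM2r// mdist_ge0.
Qed.

Section EnclosingPath.
Context (R : realType) (X : metricType R) (g : X -> R) (theta0 : R)
  (theta0_gt0 : 0 < theta0).

(** Transitivity is the reason to pass from [worthwhile] to [enclosing]: at a
    constant rate, the triangle inequality makes the costs of successive moves
    add up to a bound on the cost of the direct move, whereas a rate that
    depends on the two points allows no such comparison. *)
Lemma enclosing_trans (x y z : X) :
  enclosing g theta0 x y -> enclosing g theta0 y z -> enclosing g theta0 x z.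
Proof.
rewrite /enclosing /= => gxy gyz.
have -> : g z - g x = (g y - g x) + (g z - g y) by rewrite [RHS]addrC subrKA.
apply: le_trans (lerD gxy gyz).
by rewrite -mulrDr ler_wpM2l ?(ltW theta0_gt0)// metric_triangle.
Qed.

Context (x_ : nat -> X)
  (step : forall n, enclosing g theta0 (x_ n) (x_ n.+1)).

Lemma enclosing_path (m n : nat) :
  (m <= n)%N -> enclosing g theta0 (x_ m) (x_ n).
Proof.
move=> /subnKC <-; elim: (n - m)%N => [|k IHk].
  by rewrite addn0 /enclosing /= mdistxx mulr0 subrr.
by rewrite addnS; exact: enclosing_trans IHk (step _).
Qed.

Lemma enclosing_path_cauchy :
  has_ubound (range g) -> cauchy_ex (x_ n @[n --> \oo]).
Proof.
move=> [M gM] e e_gt0.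
have sup_gx : has_sup (range (g \o x_)).
  split; first by exists (g (x_ 0)), 0%N.
  by exists M => _ [n _ <-]; apply: gM; exists (x_ n).
have te_gt0 : 0 < theta0 * e by rewrite mulr_gt0.
have [_ [N _ <-] /= gN] := sup_adherent te_gt0 sup_gx.
exists (x_ N), N => // n /= Nn; rewrite ballEmdist /=.
rewrite -(ltr_pM2l theta0_gt0).
apply: le_lt_trans (enclosing_path Nn) _.
rewrite ltrBlDr -ltrBlDl; apply: le_lt_trans gN.
by rewrite lerB// (ub_le_sup sup_gx.2)//; exists n.
Qed.

End EnclosingPath.

Theorem mainTheorem2 (R : realType) (X : completeMetricType R) (g : X -> R)
    (theta : X -> X -> R) (theta0 : R)
    (g_bounded : has_ubound (range g))
    (theta0_gt0 : 0 < theta0)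
    (theta_ge : forall x y : X, theta0 <= theta x y) :
  (forall x : X, worthwhile g theta x `<=` enclosing g theta0 x) /\
  (forall x_ : nat -> X,
     (forall n : nat, worthwhile g theta (x_ n) (x_ n.+1)) ->
     exists xstar : X, x_ n @[n --> \oo] --> xstar).
Proof.
have sub x := worthwhile_sub_enclosing (g := g) (x := x) theta_ge.
split=> // x_ move_x.
have cauchy_x : cauchy_ex (x_ n @[n --> \oo]).
  by apply: enclosing_path_cauchy theta0_gt0 _ _ g_bounded => n; exact: sub.
by apply/cvg_ex; exact: cauchy_cvg (cauchy_exP _ cauchy_x).
Qed.
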